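(* Let $\Gamma$ be a $\mathbb Z^d$-periodic graph, $d\ge2$, with fundamental graph $\Gamma_*=(V_*,\mathcal E_* )$, $\nu=\#V_*$, and let $H=\Delta+Q$ with an arbitrary real $\mathbb Z^d$-periodic potential $Q$ (notation as in the context). Then the Lebesgue measure of the spectrum satisfies $$|\sigma(H)|\le\sum_{n=1}^{\nu}|\sigma_n(H)|\le 2\beta,\qquad \beta=\sum_{v\in V_*}\frac{\beta_v}{\varkappa_v},$$ where $\beta_v$ is the number of bridges of $\Gamma_*$ (oriented edges of $\Gamma_*$ with nonzero index) starting at $v$. Moreover, if the spectrum of $H$ has $s$ gaps $\gamma_1(H),\dots,\gamma_s(H)$, then $$\sum_{n=1}^s|\gamma_n(H)|\ge \lambda^+_\nu-\lambda^-_1-2\beta\ge C_0-2\beta,\qquad C_0=|\lambda^{0+}_\nu-q_\bullet|,\quad q_\bullet=\max_{v\in V_*}Q(v)-\min_{v\in V_*}Q(v),$$ where $\lambda^{0+}_\nu$ is the right endpoint of the spectrum of $\Delta$ and $\lambda^-_1$, $\lambda^+_\nu$ are the left and right endpoints of the spectrum of $H$.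
   Context: Setting. $\Gamma=(V,\mathcal E)$ is a connected infinite graph, possibly with loops and multiple edges, on which $\mathbb Z^d$ acts freely by graph automorphisms ($v\mapsto v+m$), every vertex has finite degree, and the quotient graph $\Gamma_*=\Gamma/\mathbb Z^d=(V_*,\mathcal E_* )$ is finite, $\nu=\#V_*$. Each undirected edge is regarded as two oppositely oriented edges; $\mathcal A$ is the set of oriented edges of $\Gamma$, $\mathcal A_*=\mathcal A/\mathbb Z^d$. The degree $\varkappa_v$ is the number of oriented edges starting at $v$. $(\Delta f)(v)=f(v)-\sum_{(v,u)\in\mathcal A}\frac{1}{\sqrt{\varkappa_v\varkappa_u}}f(u)$ on $\ell^2(V)$, $H=\Delta+Q$ with $Q$ real and $Q(v+m)=Q(v)$. Edge indices. Fix a subtree $T$ of $\Gamma$ whose vertex set $V_0$ consists of $\nu$ pairwise non-$\mathbb Z^d$-equivalent vertices; write each $v\in V$ uniquely as $v=v_0+[v]$, $v_0\in V_0$, $[v]\in\mathbb Z^d$; the index of $\mathbf e=(u,v)$ is $\tau(\mathbf e)=[v]-[u]$, which is shift invariant and thus defined on $\mathcal A_*$. Bridges are edges with nonzero index. Fiber operators and bands. For $\vartheta\in\mathbb T^d=\mathbb R^d/(2\pi\mathbb Z)^d$: $(\Delta(\vartheta)f)(v)=f(v)-\sum_{\mathbf e=(v,u)\in\mathcal A_*}\frac{e^{i\langle\tau(\mathbf e),\vartheta\rangle}}{\sqrt{\varkappa_v\varkappa_u}}f(u)$ on $\ell^2(V_* )$, $H(\vartheta)=\Delta(\vartheta)+Q$;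 $H$ is unitarily equivalent to the direct integral of $H(\vartheta)$. Eigenvalues $\lambda_1(\vartheta)\le\dots\le\lambda_\nu(\vartheta)$ of $H(\vartheta)$ define bands $\sigma_n(H)=[\lambda_n^-,\lambda_n^+]=\lambda_n(\mathbb T^d)$, $\sigma(H)=\bigcup_n\sigma_n(H)$; for $\Delta$ the eigenvalues are $\lambda^0_n(\vartheta)$ and bands $[\lambda_n^{0-},\lambda_n^{0+}]$. A band is degenerate if it is a single point (an eigenvalue of infinite multiplicity). A gap is a nonempty open interval between two neighboring nondegenerate bands.
   Formalization: Gaps are taken as all bounded components of the complement of the spectrum, so intervals next to degenerate bands count; with gaps only between nondegenerate bands the bound fails when the top band is an isolated single point. *)

(* Defs.v *)
From HB Require Import structures.
From mathcomp Require Import all_boot all_order all_algebra.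
From mathcomp Require Import all_classical all_reals all_analysis.
From mathcomp Require Import complex.
From Stdlib Require Import Relations.

Set Implicit Arguments.
Unset Strict Implicit.
Unset Printing Implicit Defensive.

Import Order.TTheory GRing.Theory Num.Theory.
Local Open Scope ring_scope.

(* A Z^d-periodic graph Gamma is encoded by its fundamental graph            *)
(*   Gamma_* : vertex set V_* = 'I_nu, finite set E of oriented edges         *)
(*   (the paper's A_* ), source/target maps, orientation reversal [rev] and the edge      *)
(*   index [tau : E -> Z^d].  The periodic graph itself is recovered as the  *)
(*   derived graph: vertices V_* x Z^d, with an oriented edge                *)
(*   (src e, m) -> (tgt e, m + tau e) for each e in E and m in Z^d.          *)
(*   The vertex v_0 + m of the paper is (v_0, m).                            *)

Section PeriodicGraph.
Variables (d nu : nat) (E : finType) (src tgt : E -> 'I_nu) (rev : E -> E)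
  (tau : E -> 'rV[int]_d).

(* each undirected edge is a pair of two opposite oriented edges *)
Definition orientation_ok : Prop :=
  (forall e, rev (rev e) = e) /\ (forall e, rev e <> e) /\
  (forall e, src (rev e) = tgt e) /\ (forall e, tgt (rev e) = src e) /\
  (forall e, tau (rev e) = - tau e).

Definition Gamma_adj (x y : 'I_nu * 'rV[int]_d) : Prop :=
  exists e, src e = x.1 /\ tgt e = y.1 /\ y.2 = x.2 + tau e.

Definition Gamma_connected : Prop :=
  forall x y, clos_refl_trans _ Gamma_adj x y.

(* The indices come from a subtree T of Gamma on the representatives
   V_0 = V_* x {0}: equivalently, the edges of index 0 connect V_*. *)
Definition zero_index_adj (u v : 'I_nu) : Prop :=
  exists e, src e = u /\ tgt e = v /\ tau e = 0.

Definition indices_from_tree : Prop :=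
  forall u v, clos_refl_trans _ zero_index_adj u v.

Definition kappa (v : 'I_nu) : nat := #|[set e | src e == v]|.

Definition beta_v (v : 'I_nu) : nat := #|[set e | (src e == v) && (tau e != 0)]|.

Variable R : realType.

Definition beta : R := \sum_(v < nu) (beta_v v)%:R / (kappa v)%:R.

Local Open Scope complex_scope.

Definition pairing (m : 'rV[int]_d) (theta : 'rV[R]_d) : R :=
  \sum_(i < d) (m ord0 i)%:~R * theta ord0 i.

Definition expi (t : R) : R[i] := (cos t) +i* (sin t).

(* Fiber operator H(theta) = Delta(theta) + Q on l^2(V_* ) *)
Definition Hfib (Q : 'I_nu -> R) (theta : 'rV[R]_d) : 'M[R[i]]_nu :=
  \matrix_(v, u)
    ((((v == u)%:R + (if v == u then Q v else 0)) : R)%:C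
     - \sum_(e | (src e == v) && (tgt e == u))
          expi (pairing (tau e) theta)
          * ((Num.sqrt ((kappa v)%:R * (kappa u)%:R : R))^-1)%:C).

Definition is_sorted_spectrum (A : 'M[R[i]]_nu) (s : seq R) : Prop :=
  sorted <=%R s /\ char_poly A = \prod_(x <- s) ('X - (x%:C)%:P).

Definition eigs (Q : 'I_nu -> R) (theta : 'rV[R]_d) : seq R :=
  xget [::] (is_sorted_spectrum (Hfib Q theta)).

(* lambda_{n+1}(theta)  (0-based index n) *)
Definition lam (Q : 'I_nu -> R) (n : nat) (theta : 'rV[R]_d) : R :=
  nth 0 (eigs Q theta) n.

Local Close Scope complex_scope.
Local Open Scope classical_set_scope.

(* band sigma_{n+1}(H) = lambda_{n+1}(T^d)  (lambda is 2pi-periodic in theta) *)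
Definition band (Q : 'I_nu -> R) (n : nat) : set R := range (lam Q n).

Definition band_lo (Q : 'I_nu -> R) (n : nat) : R := inf (band Q n).
Definition band_hi (Q : 'I_nu -> R) (n : nat) : R := sup (band Q n).

Definition spectrum (Q : 'I_nu -> R) : set R :=
  \bigcup_(n < nu) band Q n.

Definition is_gap (Q : 'I_nu -> R) (g : R * R) : Prop :=
  (g.1 < g.2)%R /\ spectrum Q g.1 /\ spectrum Q g.2 /\
  `]g.1, g.2[ `&` spectrum Q = set0.

Definition qbullet (Q : 'I_nu -> R) : R := sup (range Q) - inf (range Q).

End PeriodicGraph.

(* Main.v *)
Require Import Defs.
From HB Require Import structures.
From mathcomp Require Import all_boot all_order all_algebra.
From mathcomp Require Import all_classical all_reals all_analysis.
From mathcomp Require Import complex.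
From mathcomp Require Import perm measurable_realfun.
From mathcomp Require Import ring lra.
From Stdlib Require Import Relations.
Import Order.TTheory GRing.Theory Num.Theory.
Local Open Scope ring_scope.

Set Implicit Arguments.
Unset Strict Implicit.
Unset Printing Implicit Defensive.

Import numFieldNormedType.Exports.

(* Split H(theta) = B + W(theta), where W(theta) collects the bridges and B does
   not depend on theta.  By the inequality 2|xy| <= |x|^2 + |y|^2 applied edge
   by edge, -D <= W(theta) <= D as quadratic forms, where D is the diagonal
   matrix with entries beta_v / kappa_v.  Monotonicity of ordered eigenvalues
   puts the n-th band between the n-th eigenvalues of B - D and B + D, and the
   sum over n of these lengths is tr (2 D) = 2 beta.  The same monotonicity
   makes the lambda_n continuous, hence the bands compact, so the spectrum is closed
   and every point of [lambda_1^-, lambda_nu^+] outside it lies in a gap. *)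

(** * Ordered spectra and quadratic forms of Hermitian matrices *)

Section HermitianSpectrum.
Local Open Scope complex_scope.
Local Open Scope sesquilinear_scope.
Variables (R : realType) (n : nat).
Implicit Types (A B : 'M[R[i]]_n) (x : 'rV[R[i]]_n) (s t : seq R).

Definition nsq (z : R[i]) : R := complex.Re z ^+ 2 + complex.Im z ^+ 2.

Lemma nsq_ge0 z : 0 <= nsq z.
Proof. by rewrite addr_ge0 ?sqr_ge0. Qed.

Lemma mul_conjC_nsq (z : R[i]) : z * Num.conj z = (nsq z)%:C.
Proof.
by case: z => a b; apply/eqP; rewrite eq_complex /nsq /=; apply/andP; split;
  apply/eqP; ring.
Qed.

Lemma nsq_eq0 z : nsq z = 0 -> z = 0.
Proof.
case: z => a b /eqP; rewrite /nsq /= paddr_eq0 ?sqr_ge0 // !sqrf_eq0.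
by move=> /andP[/eqP-> /eqP->].
Qed.

Definition sqnorm x : R := \sum_i nsq (x ord0 i).
Definition qform A x : R := complex.Re ((x *m A *m x^t*) ord0 ord0).

Lemma sqnorm_ge0 x : 0 <= sqnorm x.
Proof. by apply: sumr_ge0 => i _; apply: nsq_ge0. Qed.

Lemma sqnorm_gt0 x : x != 0 -> 0 < sqnorm x.
Proof.
move=> x0; rewrite lt_def sqnorm_ge0 andbT; apply: contra x0 => /eqP x0.
apply/eqP/rowP => i; rewrite mxE; apply: nsq_eq0.
by apply: (psumr_eq0P _ x0) => // j _; exact: nsq_ge0.
Qed.

Lemma sqnormE x : (sqnorm x)%:C = (x *m x^t*) ord0 ord0.
Proof.
rewrite !mxE /sqnorm rmorph_sum; apply: eq_bigr => i _.
by rewrite !mxE mul_conjC_nsq.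
Qed.

Lemma ReD (z w : R[i]) : complex.Re (z + w) = complex.Re z + complex.Re w.
Proof. by case: z w => ? ? []. Qed.

Lemma Re_sum (I : Type) (r : seq I) (P : pred I) (F : I -> R[i]) :
  complex.Re (\sum_(i <- r | P i) F i) = \sum_(i <- r | P i) complex.Re (F i).
Proof. exact: (big_morph _ ReD). Qed.

Lemma qformD A B x : qform (A + B) x = qform A x + qform B x.
Proof. by rewrite /qform mulmxDr mulmxDl mxE ReD. Qed.

Lemma qformN A x : qform (- A) x = - qform A x.
Proof. by rewrite /qform mulmxN mulNmx mxE; case: (_ ord0 _). Qed.

Lemma qformB A B x : qform (A - B) x = qform A x - qform B x.
Proof. by rewrite qformD qformN. Qed.

Lemma qform_diag (f : 'I_n -> R) x :
  qform (diag_mx (\row_i (f i)%:C)) x = \sum_i f i * nsq (x ord0 i).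
Proof.
rewrite /qform mul_mx_diag mxE Re_sum; apply: eq_bigr => i _.
by rewrite !mxE -mulrA mulrCA mul_conjC_nsq /=; ring.
Qed.

(** The rows of [P] are an orthonormal basis of left eigenvectors, which suits forms evaluated on
    row vectors. *)
Definition spectral_frame A s (P : 'M[R[i]]_n) : Prop :=
  [/\ P \is unitarymx, size s = n &
      A = P^t* *m diag_mx (\row_i (s`_i)%:C) *m P].

(** The spectral theorem gives real eigenvalues in no particular order; sorting them permutes the
    rows of the unitary matrix. *)
Lemma hermitian_frame A : A^t* = A ->
  exists s, sorted <=%R s /\ exists P, spectral_frame A s P.
Proof.
move=> Ah.
have Aherm : A \is hermsymmx.
  by apply/is_hermitianmxP; rewrite expr0 scale1r Ah.
have /orthomx_spectralP := hermitian_normalmx Aherm.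
have := spectral_unitarymx A.
have := hermitian_spectral_diag_real Aherm.
move: (spectralmx A) (spectral_diag A) => P d dr Pu.
rewrite invmx_unitary // => AE.
pose t0 := [tuple complex.Re (d ord0 i) | i < n].
have /tuple_permP[p sp] : perm_eq (sort <=%R t0) t0 by rewrite perm_sort.
set s := sort _ _ in sp.
exists s; split; first exact/sort_le_sorted.
exists (row_perm p P); split.
- rewrite /row_perm; apply/unitarymxP/matrixP => i j; rewrite !mxE.
  have /unitarymxP/matrixP/(_ (p i) (p j)) := Pu.
  rewrite !mxE (inj_eq perm_inj) => <-.
  by apply: eq_bigr => k _; rewrite !mxE.
- by rewrite size_sort size_tuple.
rewrite {1}AE; apply/matrixP => i j.
rewrite mul_mx_diag mxE mul_mx_diag [RHS]mxE (reindex_inj (@perm_inj _ p)).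
apply: eq_bigr => k _; rewrite !mxE; congr (_ * _ * _).
rewrite sp /= (nth_map k) ?size_enum_ord // nth_ord_enum tnth_mktuple.
have /mxOverP/(_ ord0 (p k)) := dr.
by move=> /RRe_real ->.
Qed.

(** Conjugation by [P], lifted to constant polynomial matrices, leaves the characteristic
    determinant unchanged and reduces it to the diagonal case. *)
Lemma frame_char_poly A s P : spectral_frame A s P ->
  char_poly A = \prod_(y <- s) ('X - (y%:C)%:P).
Proof.
case=> Pu sz AE.
set D : 'M[R[i]]_n := diag_mx (\row_i (s`_i)%:C) in AE.
have Pun := unitarymx_unit Pu.
have -> : char_poly A = char_poly D.
  rewrite /char_poly /char_poly_mx.
  pose Pp := map_mx (@polyC R[i]) P; pose Vp := map_mx (@polyC R[i]) (invmx P).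
  have VP : Vp *m Pp = 1%:M by rewrite -map_mxM mulVmx // map_mx1.
  have -> : 'X%:M - map_mx polyC A = Vp *m ('X%:M - map_mx polyC D) *m Pp.
    rewrite mulmxBr mulmxBl -!map_mxM AE -invmx_unitary //.
    by rewrite scalar_mxC -[_%:M *m _ *m _]mulmxA VP mulmx1.
  by rewrite !det_mulmx mulrAC -det_mulmx VP det1 mul1r.
rewrite char_poly_trig ?diag_mx_is_trig //.
rewrite [in RHS](big_nth 0) sz big_mkord.
by apply: eq_bigr => i _; rewrite !mxE eqxx.
Qed.

(** The linear factors determine the roots as a multiset, and sorting fixes their order. *)
Lemma sorted_spectrum_uniq A s t :
  is_sorted_spectrum A s -> is_sorted_spectrum A t -> s = t.
Proof.
move=> [ss sE] [ts tE]; apply: le_sorted_eq => //.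
apply: (perm_map_inj (@complexI R)).
by apply: prod_XsubC_eq; rewrite !big_map -sE tE.
Qed.

Lemma hermitian_has_spectrum A : A^t* = A -> exists s, is_sorted_spectrum A s.
Proof.
move=> /hermitian_frame[s [ss [P /frame_char_poly]]].
by exists s.
Qed.

Lemma sorted_spectrum_frame A s : A^t* = A -> is_sorted_spectrum A s ->
  exists P, spectral_frame A s P.
Proof.
move=> /hermitian_frame[t [ts [P fP]]] As; exists P.
by rewrite (sorted_spectrum_uniq As (conj ts (frame_char_poly fP))).
Qed.

Lemma frame_sqnorm A s P x : spectral_frame A s P ->
  sqnorm (x *m P^t*) = sqnorm x.
Proof.
case=> Pu _ _; apply: (@complexI R); rewrite !sqnormE.
rewrite trmx_mul map_mxM map_trmx trmxK -map_mx_comp (map_mx_id (@conjCK _)).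
rewrite mulmxA; congr (fun_of_matrix _ _ _); congr (_ *m _).
by rewrite -invmx_unitary // mulmxKV // unitarymx_unit.
Qed.

(** In eigenbasis coordinates [x *m P^t*] the form is diagonal; all eigenvalue estimates below rest
    on this. *)
Lemma frame_qform A s P x : spectral_frame A s P ->
  qform A x = \sum_(i < n) s`_i * nsq ((x *m P^t*) ord0 i).
Proof.
case=> Pu _ AE; rewrite -(qform_diag (fun i => s`_i)) /qform {1}AE.
rewrite [in RHS]trmx_mul [in RHS]map_mxM map_trmx trmxK -map_mx_comp.
by rewrite (map_mx_id (@conjCK _)) !mulmxA.
Qed.

(* The columns of index [< k] come from the eigenbasis of [A], those of index
   [> k] from that of [B] and column [k] is zero: a vector killed by this
   singular matrix has [A]-energy at least [s`_k] and [B]-energy at most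
   [t`_k]. *)
Lemma spectrum_monotone A B s t (e : R) : A^t* = A -> B^t* = B ->
  is_sorted_spectrum A s -> is_sorted_spectrum B t ->
  (forall x, qform A x <= qform B x + e * sqnorm x) ->
  forall k, (k < n)%N -> s`_k <= t`_k + e.
Proof.
move=> Ah Bh As Bt leAB k kn.
have [P fP] := sorted_spectrum_frame Ah As.
have [S fS] := sorted_spectrum_frame Bh Bt.
have [Pu ssz AE] := fP; have [Su tsz BE] := fS.
pose M : 'M[R[i]]_n := \matrix_(i, j) if (j < k)%N then P^t* i j
   else if (k < j)%N then S^t* i j else 0.
have /eqP/det0P[x x0 xM] : \det M = 0.
  rewrite (expand_det_col M (Ordinal kn)) big1 // => i _.
  by rewrite mxE /= ltnn mul0r.
have sle i j : (i <= j)%N -> (j < n)%N -> s`_i <= s`_j.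
  move=> ij jn; apply: (sorted_leq_nth le_trans le_refl) => //.
  - by case: As.
  - by rewrite inE ssz (leq_ltn_trans ij).
  - by rewrite inE ssz.
have tle i j : (i <= j)%N -> (j < n)%N -> t`_i <= t`_j.
  move=> ij jn; apply: (sorted_leq_nth le_trans le_refl) => //.
  - by case: Bt.
  - by rewrite inE tsz (leq_ltn_trans ij).
  - by rewrite inE tsz.
have loA : s`_k * sqnorm x <= qform A x.
  rewrite (frame_qform _ fP) -(frame_sqnorm _ fP) mulr_sumr; apply: ler_sum => i _.
  case: (ltnP i k) => ik; last by rewrite ler_wpM2r ?nsq_ge0 // sle.
  have /rowP/(_ i) := xM; rewrite !mxE => xi.
  have -> : \sum_j x ord0 j * P^t* j i = 0.
    by rewrite -[RHS]xi; apply: eq_bigr => j _; rewrite [M _ _]mxE ik.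
  by rewrite /nsq /= expr0n /= addr0 !mulr0.
have hiB : qform B x <= t`_k * sqnorm x.
  rewrite (frame_qform _ fS) -(frame_sqnorm _ fS) mulr_sumr; apply: ler_sum => i _.
  case: (ltnP k i) => ik; last by rewrite ler_wpM2r ?nsq_ge0 // tle.
  have /rowP/(_ i) := xM; rewrite !mxE => xi.
  have -> : \sum_j x ord0 j * S^t* j i = 0.
    rewrite -[RHS]xi; apply: eq_bigr => j _; rewrite [M _ _]mxE ik.
    by rewrite ltnNge (ltnW ik).
  by rewrite /nsq /= expr0n /= addr0 !mulr0.
rewrite -(ler_pM2r (sqnorm_gt0 x0)) mulrDl.
by rewrite (le_trans loA) // (le_trans (leAB x)) // lerD2r.
Qed.

Lemma qform_ge_first A s x : A^t* = A -> is_sorted_spectrum A s ->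
  s`_0 * sqnorm x <= qform A x.
Proof.
move=> Ah As; have [P fP] := sorted_spectrum_frame Ah As.
have [_ sz _] := fP.
rewrite (frame_qform _ fP) -(frame_sqnorm _ fP) mulr_sumr; apply: ler_sum => i _.
rewrite ler_wpM2r ?nsq_ge0 //; apply: (sorted_leq_nth le_trans le_refl) => //.
- by case: As.
- by rewrite inE sz (leq_trans _ (ltn_ord i)).
- by rewrite inE sz.
Qed.

Lemma qform_le_last A s x : A^t* = A -> is_sorted_spectrum A s ->
  qform A x <= s`_n.-1 * sqnorm x.
Proof.
move=> Ah As; have [P fP] := sorted_spectrum_frame Ah As.
have [_ sz _] := fP.
rewrite (frame_qform _ fP) -(frame_sqnorm _ fP) mulr_sumr; apply: ler_sum => i _.
(* The index [i] witnesses that [n] is positive, so [n.-1] is a genuine last index. *)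
have n0 : (n.-1 < n)%N by case: (n) i => // -[].
rewrite ler_wpM2r ?nsq_ge0 //; apply: (sorted_leq_nth le_trans le_refl) => //.
- by case: As.
- by rewrite inE sz.
- by rewrite inE sz.
- by rewrite -ltnS prednK // (leq_trans _ n0).
Qed.

Lemma sum_spectrum A s : A^t* = A -> is_sorted_spectrum A s ->
  (\sum_(i < n) s`_i)%:C = \tr A.
Proof.
move=> Ah As; have [P [Pu _ ->]] := sorted_spectrum_frame Ah As.
rewrite mxtrace_mulC mulmxA (unitarymxP Pu) mul1mx mxtrace_diag rmorph_sum.
by apply: eq_bigr => i _; rewrite mxE.
Qed.

Lemma size_spectrum A s : A^t* = A -> is_sorted_spectrum A s -> size s = n.
Proof.
by move=> Ah As; have [P [_ -> _]] := sorted_spectrum_frame Ah As.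
Qed.

End HermitianSpectrum.

(** * Operators given by edge weights, and the fiber operators among them *)

Section EdgeOperators.
Local Open Scope complex_scope.
Local Open Scope sesquilinear_scope.
Variables (R : realType) (d nu : nat) (E : finType) (src tgt : E -> 'I_nu)
  (rev : E -> E) (tau : E -> 'rV[int]_d).
Hypothesis orient : orientation_ok src tgt rev tau.
Implicit Types (w : E -> R[i]) (x : 'rV[R[i]]_nu) (Q : 'I_nu -> R)
  (theta : 'rV[R]_d).

Let revK : involutive rev. Proof. by case: orient. Qed.
Let src_rev e : src (rev e) = tgt e. Proof. by case: orient => _ [_ []]. Qed.
Let tgt_rev e : tgt (rev e) = src e. Proof. by case: orient => _ [_ [_ []]]. Qed.
Let tau_rev e : tau (rev e) = - tau e.
Proof. by case: orient => _ [_ [_ []]]. Qed.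

Local Notation kap v := ((kappa src v)%:R : R).

(** Arbitrary weights let one estimate serve the full hopping term, its part without bridges, and
    differences of two hopping terms. *)
Definition edge_op w : 'M[R[i]]_nu :=
  \matrix_(v, u) \sum_(e | (src e == v) && (tgt e == u))
     w e * ((Num.sqrt (kap v * kap u))^-1)%:C.

Lemma eq_edge_op w1 w2 : w1 =1 w2 -> edge_op w1 = edge_op w2.
Proof.
move=> w12; apply/matrixP => v u; rewrite !mxE; apply: eq_bigr => e _.
by rewrite w12.
Qed.

Lemma edge_opB w1 w2 : edge_op w1 - edge_op w2 = edge_op (fun e => w1 e - w2 e).
Proof.
apply/matrixP => v u; rewrite !mxE -sumrB; apply: eq_bigr => e _.
by rewrite mulrBl.
Qed.

(** Reversing edges exchanges source and target, so it transposes the matrix while conjugating the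
    weights. *)
Lemma edge_op_herm w : (forall e, w (rev e) = Num.conj (w e)) ->
  (edge_op w)^t* = edge_op w.
Proof.
move=> wrev; apply/matrixP => v u; rewrite !mxE rmorph_sum.
rewrite [RHS](reindex_inj (can_inj revK)); apply: eq_big => e /=.
  by rewrite src_rev tgt_rev andbC.
move=> _; rewrite rmorphM wrev [kap u * _]mulrC; congr (_ * _).
exact: conjc_real.
Qed.

Lemma qform_edge_op w x : qform (edge_op w) x = \sum_e complex.Re
  (w e * ((Num.sqrt (kap (src e) * kap (tgt e)))^-1)%:C
    * (x ord0 (src e) * Num.conj (x ord0 (tgt e)))).
Proof.
rewrite /qform -Re_sum; congr (complex.Re _); rewrite mxE.
rewrite (partition_big tgt predT) //=; apply: eq_bigr => u _.
rewrite !mxE mulr_suml (partition_big src predT) //=; apply: eq_bigr => v _.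
rewrite !mxE mulr_sumr mulr_suml.
rewrite [RHS](eq_bigl (fun e => (src e == v) && (tgt e == u))); last first.
  by move=> e; rewrite andbC.
by apply: eq_bigr => e /andP[/eqP-> /eqP->]; ring.
Qed.

Lemma nsqM (a b : R[i]) : nsq (a * b) = nsq a * nsq b.
Proof. by case: a b => ? ? [? ?]; rewrite /nsq /=; ring. Qed.

Lemma nsq_conj (a : R[i]) : nsq (Num.conj a) = nsq a.
Proof. by case: a => ? ?; rewrite /nsq /= sqrrN. Qed.

Lemma nsq_real (a : R) : nsq a%:C = a ^+ 2.
Proof. by rewrite /nsq /= expr0n addr0. Qed.

(** After squaring, this is the arithmetic-geometric mean inequality for [nsq a / k] and
    [nsq b / l]. A zero [k] or [l] is harmless because its inverse is zero. *)
Lemma Re_weighted_le (w a b : R[i]) (c k l : R) : 0 <= c -> 0 <= k -> 0 <= l ->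
  nsq w <= c ^+ 2 ->
  `|complex.Re (w * ((Num.sqrt (k * l))^-1)%:C * (a * Num.conj b))|
   <= c * ((nsq a / k + nsq b / l) / 2).
Proof.
move=> c0 k0 l0 wc.
have A0 : 0 <= nsq a / k by rewrite divr_ge0 ?nsq_ge0.
have B0 : 0 <= nsq b / l by rewrite divr_ge0 ?nsq_ge0.
set z := (X in complex.Re X).
rewrite -ler_sqr ?nnegrE ?mulr_ge0 ?divr_ge0 ?addr_ge0 // real_normK ?num_real //.
apply: (@le_trans _ _ (nsq z)); first by rewrite lerDl sqr_ge0.
rewrite /z !nsqM nsq_conj nsq_real exprVn sqr_sqrtr ?mulr_ge0 //.
have -> : nsq w * (k * l)^-1 * (nsq a * nsq b) = nsq w * ((nsq a / k) * (nsq b / l)).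
  by rewrite invfM; ring.
rewrite exprMn; apply: ler_pM; rewrite ?nsq_ge0 ?(mulr_ge0 A0 B0) // {A0 B0}.
move: (nsq a / k) (nsq b / l) => A B.
rewrite -subr_ge0 (_ : _ - _ = ((A - B) / 2) ^+ 2) ?sqr_ge0 //.
by field.
Qed.

(** Each edge contributes half of its bound at its source and half at its target. As [c] is
    invariant under [rev], the target halves sum to the same value as the source halves, leaving a
    diagonal form. *)
Lemma edge_op_bound w (c : E -> R) x : (forall e, 0 <= c e) ->
  (forall e, c (rev e) = c e) -> (forall e, nsq (w e) <= c e ^+ 2) ->
  `|qform (edge_op w) x| <= \sum_e c e * (nsq (x ord0 (src e)) / kap (src e)).
Proof.
move=> c0 crev wc; rewrite qform_edge_op.
apply: (le_trans (ler_norm_sum _ _ _)).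
pose F e := nsq (x ord0 (src e)) / kap (src e).
pose G e := nsq (x ord0 (tgt e)) / kap (tgt e).
apply: (@le_trans _ _ (\sum_e c e * ((F e + G e) / 2))).
  by apply: ler_sum => e _; apply: Re_weighted_le.
have FG : \sum_e c e * G e = \sum_e c e * F e.
  rewrite [RHS](reindex_inj (can_inj revK)); apply: eq_bigr => e _.
  by rewrite crev /F /G src_rev.
have -> : \sum_e c e * ((F e + G e) / 2)
   = (\sum_e c e * F e + \sum_e c e * G e) / 2.
  by rewrite -big_split mulr_suml /=; apply: eq_bigr => e _; ring.
rewrite FG; lra.
Qed.

Lemma sum_by_src (c : E -> R) (g : 'I_nu -> R) :
  \sum_e c e * g (src e) = \sum_v (\sum_(e | src e == v) c e) * g v.
Proof.
rewrite (partition_big src predT) //=; apply: eq_bigr => v _.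
by rewrite mulr_suml; apply: eq_bigr => e /eqP->.
Qed.

Definition wexp theta : E -> R[i] := fun e => expi (pairing (tau e) theta).

Lemma HfibE Q theta : Hfib src tgt tau Q theta =
  diag_mx (\row_v (1 + Q v)%:C) - edge_op (wexp theta).
Proof.
apply/matrixP => v u; rewrite !mxE; congr (_ - _).
by case: eqP => _; rewrite ?addr0 ?mulr1n ?mulr0n.
Qed.

Lemma diag_real_herm (f : 'I_nu -> R) :
  (diag_mx (\row_v (f v)%:C))^t* = diag_mx (\row_v (f v)%:C).
Proof.
rewrite tr_diag_mx map_diag_mx; congr diag_mx; apply/rowP => i.
by rewrite !mxE; exact: conjc_real.
Qed.

Lemma hermB (A B : 'M[R[i]]_nu) : A^t* = A -> B^t* = B -> (A - B)^t* = A - B.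
Proof. by move=> Ah Bh; rewrite linearB /= map_mxB Ah Bh. Qed.

Lemma pairingN (m : 'rV[int]_d) theta : pairing (- m) theta = - pairing m theta.
Proof.
by rewrite /pairing -sumrN; apply: eq_bigr => i _; rewrite mxE rmorphN mulNr.
Qed.

Lemma expiN (t : R) : expi (- t) = Num.conj (expi t).
Proof. by rewrite /expi cosN sinN. Qed.

Lemma wexp_rev theta e : wexp theta (rev e) = Num.conj (wexp theta e).
Proof. by rewrite /wexp tau_rev pairingN expiN. Qed.

Lemma nsq_wexp theta e : nsq (wexp theta e) = 1.
Proof. by rewrite /nsq /wexp /= cos2Dsin2. Qed.

Lemma Hfib_herm Q theta :
  (Hfib src tgt tau Q theta)^t* = Hfib src tgt tau Q theta.
Proof.
rewrite HfibE hermB ?diag_real_herm // edge_op_herm //; exact: wexp_rev.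
Qed.

(** Hermitian fibers do have a sorted real spectrum, so [xget] never returns its default. *)
Lemma eigsP Q theta :
  is_sorted_spectrum (Hfib src tgt tau Q theta) (eigs src tgt tau Q theta).
Proof.
have [s Hs] := hermitian_has_spectrum (Hfib_herm Q theta).
exact: (xgetPex _ (ex_intro _ s Hs)).
Qed.

Lemma lam_monotone Q Q' theta theta' (a : R) k : (k < nu)%N ->
  (forall x, qform (Hfib src tgt tau Q theta) x
     <= qform (Hfib src tgt tau Q' theta') x + a * sqnorm x) ->
  lam src tgt tau Q k theta <= lam src tgt tau Q' k theta' + a.
Proof.
move=> knu le; apply: (spectrum_monotone (Hfib_herm Q theta)
  (Hfib_herm Q' theta') (eigsP Q theta) (eigsP Q' theta') le knu).
Qed.

(** The potential cancels in the difference of two fibers, whose edge weights are differences of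
    exponentials. [edge_op_bound] and monotonicity, used in both directions, turn this into an
    explicit modulus of continuity. *)
Lemma lam_dist Q theta theta' k : (k < nu)%N ->
  `|lam src tgt tau Q k theta - lam src tgt tau Q k theta'|
  <= \sum_e (`|cos (pairing (tau e) theta) - cos (pairing (tau e) theta')|
           + `|sin (pairing (tau e) theta) - sin (pairing (tau e) theta')|).
Proof.
move=> knu; set S := \sum_e _.
pose c e := `|cos (pairing (tau e) theta) - cos (pairing (tau e) theta')|
           + `|sin (pairing (tau e) theta) - sin (pairing (tau e) theta')|.
have diff x : `|qform (Hfib src tgt tau Q theta) x
     - qform (Hfib src tgt tau Q theta') x| <= S * sqnorm x.
  rewrite !HfibE !qformB opprB addrC addrA subrK -qformB edge_opB.
  apply: (@le_trans _ _ (\sum_e c e * (nsq (x ord0 (src e)) / kap (src e)))).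
    apply: edge_op_bound.
    - by move=> e; rewrite addr_ge0.
    - move=> e; rewrite /c tau_rev !pairingN !cosN !sinN; congr (_ + _).
      by rewrite -opprD normrN.
    - move=> e; rewrite /nsq /wexp /expi /= /c.
      set a := cos (pairing _ theta); set a' := cos (pairing _ theta').
      set b := sin (pairing _ theta); set b' := sin (pairing _ theta').
      have -> : (a' - a) ^+ 2 + (b' - b) ^+ 2 = `|a - a'| ^+ 2 + `|b - b'| ^+ 2.
        by rewrite !real_normK ?num_real //; ring.
      (* The square of the sum exceeds the sum of squares by a nonnegative cross term. *)
      have := normr_ge0 (a - a'); have := normr_ge0 (b - b'); nra.
  rewrite mulr_suml; apply: ler_sum => e _.
  rewrite ler_wpM2l ?addr_ge0 //.
  apply: (@le_trans _ _ (nsq (x ord0 (src e)))).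
    rewrite ler_piMr ?nsq_ge0 //.
    by case: (kappa _ _) => [|m]; rewrite ?invr0 // invf_le1 ?ltr0n // ler1n.
  rewrite /sqnorm (bigD1 (src e)) //= lerDl.
  by apply: sumr_ge0 => i _; exact: nsq_ge0.
have h1 : lam src tgt tau Q k theta <= lam src tgt tau Q k theta' + S.
  by apply: lam_monotone => // x; have := diff x; rewrite ler_distl => /andP[].
have h2 : lam src tgt tau Q k theta' <= lam src tgt tau Q k theta + S.
  apply: lam_monotone => // x; have := diff x.
  by rewrite ler_distl lerBlDr => /andP[].
by rewrite ler_distl lerBlDr h1 h2.
Qed.

(** * Comparison with the operator without bridges *)

Definition wzero : E -> R[i] := fun e => if tau e == 0 then 1 else 0.

(** The matrix B of the splitting: an edge of index zero has exponential 1 at every [theta]. *)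
Definition bridgeless Q : 'M[R[i]]_nu :=
  diag_mx (\row_v (1 + Q v)%:C) - edge_op wzero.

(** The diagonal matrix D, whose trace is [beta]. *)
Definition bridge_diag : 'M[R[i]]_nu :=
  diag_mx (\row_v ((beta_v src tau v)%:R / kap v)%:C).

Lemma bridgeless_herm Q : (bridgeless Q)^t* = bridgeless Q.
Proof.
rewrite hermB ?diag_real_herm // edge_op_herm // => e.
by rewrite /wzero tau_rev oppr_eq0; case: eqP; rewrite ?rmorph1 ?rmorph0.
Qed.

(** Only bridges survive in the difference, with weights of modulus 1, so [edge_op_bound] applies
    with [c] the indicator of bridges. *)
Lemma Hfib_bridge_bound Q theta x :
  `|qform (Hfib src tgt tau Q theta) x - qform (bridgeless Q) x|
    <= qform bridge_diag x.
Proof.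
rewrite HfibE !qformB opprB addrC addrA subrK -qformB edge_opB.
pose c e : R := (tau e != 0)%:R.
apply: (@le_trans _ _ (\sum_e c e * (nsq (x ord0 (src e)) / kap (src e)))).
  apply: edge_op_bound.
  - by move=> e; rewrite ler0n.
  - by move=> e; rewrite /c tau_rev oppr_eq0.
  - move=> e; rewrite /c /wzero; case: eqP => [te|_] /=.
      rewrite /wexp te /expi.
      have -> : pairing (0 : 'rV[int]_d) theta = 0.
        by rewrite /pairing big1 // => i _; rewrite mxE mul0r.
      by rewrite /nsq cos0 sin0 /= !subrr expr0n addr0.
    rewrite /nsq /wexp /= !sub0r !sqrrN expr1n.
    by rewrite cos2Dsin2.
rewrite (sum_by_src c (fun v => nsq (x ord0 v) / kap v)).
rewrite (qform_diag (fun v => (beta_v src tau v)%:R / kap v)).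
(* The terms are in fact equal: summing [c] over the edges leaving [v] counts its bridges. *)
apply: ler_sum => v _; rewrite le_eqVlt; apply/orP; left; apply/eqP.
rewrite mulrA mulrAC; congr (_ / _ * _).
rewrite /beta_v -sum1_card natr_sum big_mkcond [RHS]big_mkcond.
by apply: eq_bigr => e _; rewrite inE /c; case: (src e == v) => //=; case: eqP.
Qed.

(** The witnesses are the ordered eigenvalues of B - D and B + D, which do not depend on [theta]. *)
Lemma lam_two_sided Q : exists lo hi : 'I_nu -> R,
  (forall (n : 'I_nu) theta, lo n <= lam src tgt tau Q n theta <= hi n) /\
  \sum_n (hi n - lo n) = 2 * beta src tau R.
Proof.
have Dh : bridge_diag^t* = bridge_diag by exact: diag_real_herm.
have Mh : (bridgeless Q - bridge_diag)^t* = bridgeless Q - bridge_diag.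
  exact: hermB (bridgeless_herm Q) Dh.
have Ph : (bridgeless Q + bridge_diag)^t* = bridgeless Q + bridge_diag.
  by rewrite linearD /= map_mxD bridgeless_herm Dh.
have [s Hs] := hermitian_has_spectrum Mh.
have [t Ht] := hermitian_has_spectrum Ph.
exists (fun n => s`_n), (fun n => t`_n); split.
  move=> n theta; apply/andP; split.
    rewrite -[leRHS]addr0.
    apply: (spectrum_monotone Mh (Hfib_herm Q theta) Hs (eigsP Q theta)) => // x.
    have := Hfib_bridge_bound Q theta x; rewrite ler_distl => /andP[].
    by rewrite qformB mul0r addr0.
  rewrite -[leRHS]addr0.
  apply: (spectrum_monotone (Hfib_herm Q theta) Ph (eigsP Q theta) Ht) => // x.
  have := Hfib_bridge_bound Q theta x; rewrite ler_distl => /andP[].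
  by rewrite qformD mul0r addr0.
(* Sums of eigenvalues are traces; the trace of B cancels and twice that of D remains. *)
apply: (@complexI R); rewrite sumrB rmorphB.
rewrite /= (sum_spectrum Ph Ht) (sum_spectrum Mh Hs).
have trN : \tr (- bridge_diag) = - \tr bridge_diag.
  by rewrite -scaleN1r mxtraceZ mulN1r.
rewrite !mxtraceD trN opprD opprK.
rewrite addrACA subrr add0r mxtrace_diag -mulr2n rmorphM /= rmorph_nat mulr_natl.
congr (_ *+ 2); rewrite /beta rmorph_sum; apply: eq_bigr => v _.
by rewrite mxE.
Qed.

End EdgeOperators.

(** * Closed sets of reals, their gaps, and integer shifts of periodic functions *)

Section RealSets.
Variable R : realType.
Local Open Scope classical_set_scope.
Implicit Types (S : set R).

Lemma closed_sup_mem S : closed S -> S !=set0 -> has_ubound S -> S (sup S).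
Proof.
by move=> /closure_id cS S0 Sub; rewrite [X in X _]cS; exact: closure_sup.
Qed.

Lemma closed_inf_mem S : closed S -> S !=set0 -> has_lbound S -> S (inf S).
Proof.
move=> cS S0 Slb.
have := @closed_sup_mem (-%R @` S).
rewrite /inf => H.
have [||| y Sy yE] := H.
- have -> : -%R @` S = -%R @^-1` S.
    apply/seteqP; split => [_ [z Sz <-]|z Sz] /=; first by rewrite opprK.
    by exists (- z) => //; rewrite opprK.
  by apply: preimage_closed => // z _; exact: opp_continuous.
- by case: S0 => z Sz; exists (- z), z.
- by case: Slb => m Sm; exists (- m) => _ [z Sz <-]; rewrite lerN2; exact: Sm.
- by rewrite -yE opprK.
Qed.

(** The endpoints are the supremum of [S] below [y] and the infimum of [S] above it: closedness puts
    both in [S], hence both differ from [y]. *)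
Lemma closed_complement_gap S (a b y : R) : closed S -> S a -> S b ->
  a <= y <= b -> ~ S y ->
  exists g : R * R, [/\ g.1 < y < g.2, S g.1, S g.2 & `]g.1, g.2[ `&` S = set0].
Proof.
move=> cS Sa Sb /andP[ay yb] Sy.
pose A := S `&` [set z | z <= y]; pose B := S `&` [set z | y <= z].
have A0 : A !=set0 by exists a.
have B0 : B !=set0 by exists b.
have ubA : has_ubound A by exists y => z [].
have lbB : has_lbound B by exists y => z [].
have [Ss sy] : A (sup A).
  by apply: closed_sup_mem => //; apply: closedI => //; exact: closed_le.
have [Si yi] : B (inf B).
  by apply: closed_inf_mem => //; apply: closedI => //; exact: closed_ge.
exists (sup A, inf B); split => //=.
  by rewrite !lt_def sy yi !andbT; apply/andP; split; apply/eqP => e; apply: Sy;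
    [rewrite e | rewrite -e].
apply/seteqP; split => // z [] /=; rewrite in_itv /= => /andP[sz zi] Sz.
case: (leP z y) => zy.
  by have := ub_le_sup ubA (conj Sz zy); rewrite leNgt sz.
by have := ge_inf lbB (conj Sz (ltW zy)); rewrite leNgt zi.
Qed.

Lemma periodicz (f : R -> R) (T : R) : periodic f T ->
  forall (z : int) a, f (a + T *~ z) = f a.
Proof.
move=> fT [n|n] a; first exact: periodicn.
by rewrite NegzE mulrNz -[LHS](periodicn fT n.+1) -pmulrn subrK.
Qed.

End RealSets.

(** * Continuity of the eigenvalues and compactness of the bands *)

Section Bands.
Local Open Scope complex_scope.
Local Open Scope classical_set_scope.
Variables (R : realType) (d nu : nat) (E : finType) (src tgt : E -> 'I_nu)
  (rev : E -> E) (tau : E -> 'rV[int]_d).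
Hypothesis orient : orientation_ok src tgt rev tau.
Implicit Types (x : 'rV[R[i]]_nu) (Q : 'I_nu -> R) (theta : 'rV[R]_d).

Local Notation lam := (lam src tgt tau).
Local Notation band := (band src tgt tau).
Local Notation Hfib := (Hfib src tgt tau).
Local Notation spectrum := (spectrum src tgt tau).
Local Notation kap v := ((kappa src v)%:R : R).

Lemma pairing_continuous (m : 'rV[int]_d) : continuous (@pairing d R m).
Proof.
apply: (@continuous_big _ _ _ _ _ add_continuous) => i _ theta.
by apply: continuousM; [exact: cst_continuous|exact: coord_continuous].
Qed.

(** The majorant from [lam_dist] is continuous in the second point and vanishes when the points
    coincide. *)
Lemma lam_continuous Q k : (k < nu)%N -> continuous (lam Q k).
Proof.
move=> knu theta; apply/(@cvgrPdist_lt _ _ _ (nbhs theta)) => eps eps0.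
pose D (theta' : 'rV[R]_d) : R :=
  \sum_e (`|cos (pairing (tau e) theta) - cos (pairing (tau e) theta')|
        + `|sin (pairing (tau e) theta) - sin (pairing (tau e) theta')|).
have cdist (f : R -> R) (m : 'rV[int]_d) (c : R) : continuous f ->
    continuous (fun t : 'rV[R]_d => `|c - f (pairing m t)|).
  move=> cf t.
  apply: (@continuous_comp _ _ _ (fun t => c - f (pairing m t)) Num.norm).
    apply: continuousB; first exact: cst_continuous.
    apply: (@continuous_comp _ _ _ (@pairing d R m) f); last exact: cf.
    exact: pairing_continuous.
  exact: norm_continuous.
have cD : continuous D.
  apply: (@continuous_big _ _ _ _ _ add_continuous) => e _ t.
  apply: (@continuousD _ _ _
    (fun t : 'rV[R]_d => `|cos (pairing (tau e) theta) - cos (pairing (tau e) t)|)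
    (fun t : 'rV[R]_d => `|sin (pairing (tau e) theta) - sin (pairing (tau e) t)|)).
    by apply: cdist; exact: continuous_cos.
  by apply: cdist; exact: continuous_sin.
have /(@cvgrPdist_lt _ _ _ (nbhs theta))/(_ eps eps0) := cD theta.
have -> : D theta = 0.
  by rewrite /D big1 // => e _; rewrite !subrr normr0 addr0.
apply: filterS => t; rewrite sub0r normrN => Dt.
apply: le_lt_trans (lam_dist orient Q theta t knu) _.
exact: le_lt_trans (ler_norm _) Dt.
Qed.

(** Integer indices make the fiber periodic with period 2 pi in each coordinate, so a compact box
    can replace the torus. *)
Lemma lam_fundamental_box Q k theta : exists2 theta' : 'rV[R]_d,
  (forall i, `[0, pi *+ 2] (theta' ord0 i)) & lam Q k theta' = lam Q k theta.
Proof.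
have T0 : 0 < pi *+ 2 :> R by rewrite mulrn_wgt0 // pi_gt0.
pose z i := Num.floor (theta ord0 i / (pi *+ 2)).
pose theta' : 'rV[R]_d := \row_i (theta ord0 i - (pi *+ 2) *~ z i).
exists theta'.
  move=> i; rewrite mxE /= in_itv /= -mulrzr.
  have /andP[lo hi] := floor_itv (theta ord0 i / (pi *+ 2)).
  rewrite intrD /= in hi; rewrite -/(z i) in lo hi.
  have tE : theta ord0 i = (theta ord0 i / (pi *+ 2)) * (pi *+ 2).
    by rewrite divfK // gt_eqF.
  rewrite [in X in X && _]tE [in X in _ && X]tE.
  move: (theta ord0 i / (pi *+ 2)) lo hi => y lo hi.
  by move: (pi *+ 2) T0 => T T0; nra.
suff H : Hfib Q theta' = Hfib Q theta by rewrite /Defs.lam /eigs H.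
rewrite !HfibE; congr (_ - _); apply: eq_edge_op => e; rewrite /wexp.
have -> : pairing (tau e) theta = pairing (tau e) theta'
   + (pi *+ 2) *~ (\sum_i tau e ord0 i * z i).
  rewrite /pairing -mulrzr rmorph_sum mulr_sumr -big_split /=.
  by apply: eq_bigr => i _; rewrite mxE -mulrzr rmorphM /=; ring.
by rewrite /expi (periodicz (@cosD2pi R)) (periodicz (@sinD2pi R)).
Qed.

Lemma band_compact Q k : (k < nu)%N -> compact (band Q k).
Proof.
move=> knu.
have -> : band Q k = lam Q k @`
    [set v : 'rV[R]_d | forall i, `[0, pi *+ 2] (v ord0 i)].
  apply/seteqP; split => [y [theta _ <-]|y [theta _ <-]]; last by exists theta.
  by have [t ? ?] := lam_fundamental_box Q k theta; exists t.
apply: continuous_compact; first exact/continuous_subspaceT/lam_continuous.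
by apply: (@rV_compact _ _ (fun=> `[0, pi *+ 2])) => _; exact: segment_compact.
Qed.

Lemma band_closed Q k : (k < nu)%N -> closed (band Q k).
Proof. by move=> /band_compact-/(_ Q); apply: compact_closed; exact: Rhausdorff. Qed.

Lemma band_has_ubound Q k : (k < nu)%N -> has_ubound (band Q k).
Proof.
move=> knu; have [lo [hi [H _]]] := lam_two_sided orient Q.
exists (hi (Ordinal knu)) => _ [theta _ <-].
by have /andP[] := H (Ordinal knu) theta.
Qed.

Lemma band_has_lbound Q k : (k < nu)%N -> has_lbound (band Q k).
Proof.
move=> knu; have [lo [hi [H _]]] := lam_two_sided orient Q.
exists (lo (Ordinal knu)) => _ [theta _ <-].
by have /andP[] := H (Ordinal knu) theta.
Qed.

Lemma band_nonempty Q k : band Q k !=set0.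
Proof. by exists (lam Q k 0), 0. Qed.

Lemma lam_le_band_hi Q k theta : (k < nu)%N ->
  lam Q k theta <= band_hi src tgt tau Q k.
Proof. by move=> knu; apply: ub_le_sup (band_has_ubound Q knu) _ _; exists theta. Qed.

Lemma band_lo_le_lam Q k theta : (k < nu)%N ->
  band_lo src tgt tau Q k <= lam Q k theta.
Proof. by move=> knu; apply: ge_inf (band_has_lbound Q knu) _ _; exists theta. Qed.

(** * Lebesgue measure of the spectrum and total length of the gaps *)

Lemma spectrum_closed Q : closed (spectrum Q).
Proof. by apply: closed_bigcup => // k knu; exact: band_closed. Qed.

Lemma measurable_band Q k : (k < nu)%N -> measurable (band Q k).
Proof. by move=> /band_compact-/(_ Q); exact: compact_measurable. Qed.

Lemma measurable_spectrum Q : measurable (spectrum Q).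
Proof. by apply: closed_measurable; exact: spectrum_closed. Qed.

Lemma measure_spectrum_le Q : (lebesgue_measure (spectrum Q)
  <= \sum_(n < nu) lebesgue_measure (band Q n))%E.
Proof.
apply: (@content_subadditive _ _ _ lebesgue_measure (spectrum Q) (band Q) nu).
- by move=> k /(measurable_band Q).
- exact: measurable_spectrum.
- by rewrite /Defs.spectrum bigcup_mkord.
Qed.

Lemma measure_bands_le Q :
  (\sum_(n < nu) lebesgue_measure (band Q n) <= (2 * beta src tau R)%:E)%E.
Proof.
have [lo [hi [H <-]]] := lam_two_sided orient Q.
rewrite -sumEFin; apply: lee_sum => n _.
have loh : lo n <= hi n by have /andP[a b] := H n 0; exact: le_trans a b.
have -> : (hi n - lo n)%:E = lebesgue_measure (`[lo n, hi n] : set R).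
  rewrite lebesgue_measure_itv /= lte_fin; case: ltgtP loh => // -> _.
  by rewrite subrr.
apply: le_measure; rewrite ?inE //; first exact: measurable_band.
by move=> _ [theta _ <-] /=; rewrite in_itv /=; exact: H.
Qed.

(** The spectrum and the gaps together cover [[a, b]], and the spectrum has measure at most
    [2 * beta]; subadditivity gives the rest. *)
Lemma gaps_total_length Q (a b : R) (gs : seq (R * R)) :
  (forall g, is_gap src tgt tau Q g <-> g \in gs) ->
  spectrum Q a -> spectrum Q b ->
  b - a - 2 * beta src tau R <= \sum_(g <- gs) (g.2 - g.1).
Proof.
move=> gsP Sa Sb.
have gs_lt g : g \in gs -> g.1 < g.2 by move/gsP => [].
have gs0 : 0 <= \sum_(g <- gs) (g.2 - g.1).
  by rewrite big_seq; apply: sumr_ge0 => g /gs_lt/ltW; rewrite subr_ge0.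
have bM := le_trans (measure_spectrum_le Q) (measure_bands_le Q).
have beta0 : 0 <= 2 * beta src tau R.
  by rewrite -lee_fin; apply: le_trans bM.
(* When [b < a] the left side is negative and the right side is nonnegative. *)
case: (leP a b) => ab; last lra.
pose gap k : set R := `](nth (0, 0) gs k).1, (nth (0, 0) gs k).2[.
(* Slot 0 holds the spectrum and slot [k'.+1] the gap of index [k'], so a single finite family
   covers the interval. *)
pose F k := if k is k'.+1 then gap k' else spectrum Q.
have cover : (lebesgue_measure (`[a, b] : set R)
    <= \sum_(k < (size gs).+1) lebesgue_measure (F k))%E.
  apply: (@content_subadditive _ _ _ lebesgue_measure _ F).
  - by move=> [|k] _ /=; [exact: measurable_spectrum|exact: measurable_itv].
  - exact: measurable_itv.
  - rewrite -bigcup_mkord => y /=; rewrite in_itv /= => yab.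
    have [Sy|Sy] := pselect (spectrum Q y); first by exists 0%N.
    have [g [/andP[g1 g2] S1 S2 Sg]] :=
      closed_complement_gap (@spectrum_closed Q) Sa Sb yab Sy.
    have gin : g \in gs by apply/gsP; split; [exact: lt_trans g1 g2|].
    exists (index g gs).+1; first by rewrite /= ltnS index_mem.
    by rewrite /= /gap nth_index //= in_itv /= g1.
rewrite big_ord_recl /= in cover.
have gapsE : (\sum_(k < size gs) lebesgue_measure (gap k)
    = (\sum_(g <- gs) (g.2 - g.1))%:E)%E.
  rewrite -sumEFin [RHS](big_nth (0, 0)) big_mkord; apply: eq_bigr => k _.
  by rewrite /gap lebesgue_measure_itv /= lte_fin gs_lt ?mem_nth.
have : ((b - a)%:E <= (2 * beta src tau R)%:E + (\sum_(g <- gs) (g.2 - g.1))%:E)%E.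
  have -> : (b - a)%:E = lebesgue_measure (`[a, b] : set R).
    rewrite lebesgue_measure_itv /= lte_fin; case: ltgtP ab => // -> _.
    by rewrite subrr.
  by apply: le_trans cover _; rewrite gapsE leeD2r.
by rewrite -EFinD lee_fin; lra.
Qed.

(** * Test vectors for the Laplacian and the width of the spectrum *)

Lemma qform_Hfib Q theta x : qform (Hfib Q theta) x =
  qform (Hfib (fun=> 0) theta) x + \sum_v Q v * nsq (x ord0 v).
Proof.
rewrite !HfibE !qformB (qform_diag (fun v => 1 + Q v)).
rewrite (qform_diag (fun v => 1 + 0)) addrAC -big_split /=; congr (_ - _).
by apply: eq_bigr => v _; ring.
Qed.

(** With unit weights, [edge_op_bound] bounds the hopping term by the identity form: the degree of
    each vertex cancels its normalization. *)
Lemma Laplacian_ge0 theta x : 0 <= qform (Hfib (fun=> 0) theta) x.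
Proof.
rewrite HfibE qformB (qform_diag (fun v => 1 + 0)) subr_ge0.
apply: le_trans (ler_norm _) _.
apply: le_trans (edge_op_bound orient (c := fun=> 1) x _ _ _) _ => //.
  by move=> e; rewrite nsq_wexp expr1n.
rewrite (sum_by_src src (fun=> 1) (fun v => nsq (x ord0 v) / kap v)).
apply: ler_sum => v _; rewrite addr0 mul1r.
have -> : \sum_(e | src e == v) 1 = kap v :> R.
  by rewrite /kappa -sum1_card natr_sum; apply: eq_bigl => e; rewrite inE.
case: (kappa src v) => [|k]; first by rewrite mul0r nsq_ge0.
by rewrite mulrC divfK // pnatr_eq0.
Qed.

Definition sqrt_degree : 'rV[R[i]]_nu := \row_v (Num.sqrt (kap v))%:C.

Lemma nsq_sqrt_degree v : nsq (sqrt_degree ord0 v) = kap v.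
Proof. by rewrite mxE nsq_real sqr_sqrtr ?ler0n. Qed.

Lemma kappa_src_gt0 e : 0 < kap (src e).
Proof. by rewrite ltr0n; apply/card_gt0P; exists e; rewrite inE. Qed.

Lemma kappa_tgt_gt0 e : 0 < kap (tgt e).
Proof. by case: orient => _ [_ [<- _]]; exact: kappa_src_gt0. Qed.

(** At [theta = 0] each oriented edge contributes exactly 1 to the hopping term, and the sum of the
    degrees is also the number of oriented edges. *)
Lemma Laplacian_sqrt_degree : qform (Hfib (fun=> 0) 0) sqrt_degree = 0.
Proof.
rewrite HfibE qformB (qform_diag (fun v => 1 + 0)) qform_edge_op.
have -> : \sum_v (1 + 0) * nsq (sqrt_degree ord0 v) = \sum_(e : E) 1.
  rewrite [RHS](partition_big src predT) //=; apply: eq_bigr => v _.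
  rewrite nsq_sqrt_degree addr0 mul1r /kappa -sum1_card natr_sum.
  by apply: eq_bigl => e; rewrite inE.
rewrite -sumrB big1 // => e _; apply/eqP; rewrite subr_eq0; apply/eqP.
have k1 := kappa_src_gt0 e; have k2 := kappa_tgt_gt0 e.
rewrite /wexp /expi !mxE /=.
have -> : pairing (tau e) (0 : 'rV[R]_d) = 0.
  by rewrite /pairing big1 // => i _; rewrite mxE mulr0.
rewrite cos0 sin0 sqrtrM ?ler0n // oppr0 !mulr0 !mul0r !subr0 !addr0 mul1r.
by rewrite mulr0 subr0 mulVf ?mulf_neq0 ?sqrtr_eq0 -?ltNge.
Qed.

(** In positive dimension [v] has a distinct translate, and a path to it must start with an edge
    leaving [v]. *)
Lemma kappa_gt0 (v : 'I_nu) : (0 < d)%N -> Gamma_connected src tgt tau ->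
  0 < kap v.
Proof.
move=> d0 conn.
have H := clos_rt_rt1n _ _ _ _ (conn (v, 0) (v, const_mx 1)).
inversion H as [H0|y z [e [se _]]].
  by have /rowP/(_ (Ordinal d0)) := H0; rewrite !mxE.
by rewrite /= in se; rewrite -se kappa_src_gt0.
Qed.

Lemma lam_first_le_qform Q theta x :
  lam Q 0 theta * sqnorm x <= qform (Hfib Q theta) x.
Proof. exact: qform_ge_first (Hfib_herm orient Q theta) (eigsP orient Q theta). Qed.

Lemma qform_le_lam_last Q theta x :
  qform (Hfib Q theta) x <= lam Q nu.-1 theta * sqnorm x.
Proof. exact: qform_le_last (Hfib_herm orient Q theta) (eigsP orient Q theta). Qed.

Lemma nsq_delta (v u : 'I_nu) :
  nsq ((delta_mx ord0 v : 'rV[R[i]]_nu) ord0 u) = (u == v)%:R.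
Proof. by rewrite mxE eqxx /=; case: eqP; rewrite /nsq /= ?expr1n ?expr0n addr0. Qed.

Lemma sum_delta (f : 'I_nu -> R) v :
  \sum_u f u * nsq ((delta_mx ord0 v : 'rV[R[i]]_nu) ord0 u) = f v.
Proof.
rewrite (bigD1 v) //= nsq_delta eqxx mulr1 big1 ?addr0 // => u /negbTE uv.
by rewrite nsq_delta uv mulr0.
Qed.

Lemma sqnorm_delta v : sqnorm (delta_mx ord0 v : 'rV[R[i]]_nu) = 1.
Proof.
by rewrite -[RHS](sum_delta (fun=> 1) v); apply: eq_bigr => u _; rewrite mul1r.
Qed.

(* One bound tests H(0) against the square root of the degree, the zero mode of
   the Laplacian; the other tests it at delta functions sitting at a maximum and
   at a minimum of Q. *)
Lemma spectrum_width Q : (0 < d)%N -> (0 < nu)%N -> Gamma_connected src tgt tau ->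
  `|band_hi src tgt tau (fun=> 0) nu.-1 - qbullet Q|
  <= band_hi src tgt tau Q nu.-1 - band_lo src tgt tau Q 0.
Proof.
(* One sign of the absolute value follows from [a0 <= a - m] and [b <= l0 <= M], the other from
   [M <= l1 <= a] and [b <= l0 <= z + m <= a0 + m]. *)
have arith (a0 a b z l0 l1 M m : R) : a0 <= a - m -> l0 <= M -> M <= l1 ->
    l0 <= z + m -> z <= a0 -> l1 <= a -> b <= l0 -> `|a0 - (M - m)| <= a - b.
  by move=> *; rewrite ler_norml; apply/andP; split; lra.
move=> d0 nu0 conn; have nu1 : (nu.-1 < nu)%N by rewrite prednK.
pose v0 : 'I_nu := Ordinal nu0.
have [vmax Qmax] : exists v, forall u, Q u <= Q v.
  by case: (@arg_maxP _ _ _ v0 predT Q isT) => v _ H; exists v => u; exact: H.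
have [vmin Qmin] : exists v, forall u, Q v <= Q u.
  by case: (@arg_minP _ _ _ v0 predT Q isT) => v _ H; exists v => u; exact: H.
have -> : qbullet Q = Q vmax - Q vmin.
  rewrite /qbullet; congr (_ - _); apply/eqP; rewrite eq_le; apply/andP; split.
  - by apply: ge_sup; [exists (Q v0), v0|move=> _ [u _ <-]].
  - by apply: ub_le_sup; [exists (Q vmax) => _ [u _ <-]|exists vmax].
  - by apply: ge_inf; [exists (Q vmin) => _ [u _ <-]|exists vmin].
  - by apply: lb_le_inf; [exists (Q v0), v0|move=> _ [u _ <-]].
have hi_low : band_hi src tgt tau (fun=> 0) nu.-1
    <= band_hi src tgt tau Q nu.-1 - Q vmin.
  apply: ge_sup; first exact: band_nonempty.
  move=> _ [theta _ <-].
  apply: (@le_trans _ _ (lam Q nu.-1 theta - Q vmin)); last first.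
    by rewrite lerD2r; exact: lam_le_band_hi.
  apply: (lam_monotone orient) => // x.
  rewrite [qform (Hfib Q _) _]qform_Hfib -addrA lerDl mulNr subr_ge0.
  by rewrite mulr_sumr; apply: ler_sum => v _; rewrite ler_wpM2r ?nsq_ge0.
have lo_up : lam Q 0 0 <= Q vmax.
  have x0 : 0 < sqnorm sqrt_degree.
    apply: sqnorm_gt0; apply/eqP => /rowP/(_ v0) /eqP.
    have := nsq_sqrt_degree v0; have := kappa_gt0 v0 d0 conn.
    by move=> k0 kE /eqP x0; move: k0; rewrite -kE x0 mxE /nsq /= !expr0n addr0 ltxx.
  rewrite -(ler_pM2r x0).
  apply: le_trans (lam_first_le_qform Q 0 sqrt_degree) _.
  rewrite qform_Hfib Laplacian_sqrt_degree add0r mulr_sumr.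
  by apply: ler_sum => v _; rewrite ler_wpM2r ?nsq_ge0.
have hi_max : Q vmax <= lam Q nu.-1 0.
  rewrite -[leRHS]mulr1 -(sqnorm_delta vmax).
  apply: le_trans (qform_le_lam_last Q 0 _).
  by rewrite qform_Hfib sum_delta lerDr Laplacian_ge0.
have lo_min : lam Q 0 0 <= lam (fun=> 0) nu.-1 0 + Q vmin.
  rewrite -[leLHS]mulr1 -(sqnorm_delta vmin).
  apply: le_trans (lam_first_le_qform Q 0 _) _.
  rewrite qform_Hfib sum_delta lerD2r -[leRHS]mulr1 -(sqnorm_delta vmin).
  exact: qform_le_lam_last.
exact: arith hi_low lo_up hi_max lo_min (lam_le_band_hi _ _ nu1)
  (lam_le_band_hi _ _ nu1) (band_lo_le_lam _ _ nu0).
Qed.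

Lemma lam_no_vertex Q k theta : nu = 0%N -> lam Q k theta = 0.
Proof.
move=> nu0; rewrite /Defs.lam nth_default //.
by rewrite (size_spectrum (Hfib_herm orient Q theta) (eigsP orient Q theta)) nu0.
Qed.

End Bands.

Theorem theorem2p2 (R : realType) (d nu : nat) (E : finType)
  (src tgt : E -> 'I_nu) (rev : E -> E) (tau : E -> 'rV[int]_d)
  (Q : 'I_nu -> R) :
  (2 <= d)%N ->
  orientation_ok src tgt rev tau ->
  Gamma_connected src tgt tau ->
  indices_from_tree src tgt tau ->
  let mu := @lebesgue_measure R in
  let b := beta src tau R in
  let lam1m := band_lo src tgt tau Q 0 in
  let lamnup := band_hi src tgt tau Q nu.-1 in
  let lam0nup := band_hi src tgt tau (fun _ => 0) nu.-1 in
  let C0 := `|lam0nup - qbullet Q| in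
  ((mu (spectrum src tgt tau Q)
      <= \sum_(n < nu) mu (band src tgt tau Q n))%E /\
   (\sum_(n < nu) mu (band src tgt tau Q n) <= (2 * b)%:E)%E) /\
  (forall gs : seq (R * R), uniq gs ->
     (forall g, is_gap src tgt tau Q g <-> g \in gs) ->
     lamnup - lam1m - 2 * b <= \sum_(g <- gs) (g.2 - g.1) /\
     C0 - 2 * b <= lamnup - lam1m - 2 * b).
Proof.
move=> d2 orient conn _ mu b lam1m lamnup lam0nup C0; split.
  by split; [exact: measure_spectrum_le orient Q|exact: measure_bands_le orient Q].
move=> gs _ gsP; case: (posnP nu) => [nu0|nu0].
  (* Without vertices every band is the point 0, the default of [nth], while [C0] and [b] vanish;
     only nonnegativity of the gap lengths remains. *)
  have bandE Q' k : band src tgt tau Q' k = [set 0]%classic.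
    rewrite predeqE => y; split => [[theta _ <-]|->].
      exact: lam_no_vertex orient Q' k theta nu0.
    by exists 0 => //; exact: lam_no_vertex orient Q' k 0 nu0.
  have rQ : range Q = set0.
    by rewrite predeqE => y; split => // -[[m mnu]]; exfalso; rewrite nu0 in mnu.
  have -> : C0 = 0.
    by rewrite /C0 /lam0nup /band_hi bandE sup1 /qbullet rQ sup0 inf0 !subrr normr0.
  have -> : b = 0.
    by rewrite /b /beta big1 // => v; case: v => m mnu; exfalso; rewrite nu0 in mnu.
  rewrite /lamnup /lam1m /band_hi /band_lo !bandE sup1 inf1 !mulr0 !subrr.
  split => //; rewrite big_seq; apply: sumr_ge0 => g /gsP [] /ltW.
  by rewrite subr_ge0.
have nu1 : (nu.-1 < nu)%N by rewrite prednK.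
split.
  (* Bands are closed, bounded and nonempty, so both endpoints of the spectrum are attained and
     belong to it. *)
  apply: (gaps_total_length orient gsP).
    exists 0%N => //; apply: closed_inf_mem.
    - exact: band_closed orient Q _ nu0.
    - exact: band_nonempty.
    - exact: band_has_lbound orient Q _ nu0.
  exists nu.-1 => //; apply: closed_sup_mem.
  - exact: band_closed orient Q _ nu1.
  - exact: band_nonempty.
  - exact: band_has_ubound orient Q _ nu1.
by rewrite lerD2r; apply: (spectrum_width orient Q (ltnW d2) nu0 conn).
Qed.
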